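(* Consider the multiobjective composite problem $\min_{x\in\mathbb{R}^n} F(x)$ with $F=(F_1,\dots,F_m)$, $F_i=f_i+g_i$, where each $g_i$ is proper, convex and lower semicontinuous and each $f_i:\mathbb{R}^n\to\mathbb{R}$ is twice continuously differentiable, $\mu$-strongly convex for some $\mu>0$, and has $L_2$-Lipschitz continuous Hessian. Let $\{x^k\}$ be the (infinite) sequence generated by the Newton-type proximal gradient method described in the context (with parameter $\sigma$), and let $x^*$ be its limit. Then for every $0<\epsilon\le(1-\sigma)\mu$ there exists $K_\epsilon>0$ such that for all $k\ge K_\epsilon$, \[ \|x^{k+1}-x^*\|\le\frac{(2\tau_k+1)L_2}{3\mu-\tau_kL_2\|x^k-x^*\|}\,\|x^k-x^*\|^2, \] where $\tau_k:=\frac{\|x^{k+1}-x^k\|}{\|x^k-x^*\|}\in\Big[\frac{\mu-\sqrt{2\mu\epsilon-\epsilon^2}}{\mu-\epsilon},\frac{\mu+\sqrt{2\mu\epsilon-\epsilon^2}}{\mu-\epsilon}\Big]$. Furthermore, $\{x^k\}$ converges quadratically to $x^*$.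
   Context: Notation: $[m]=\{1,\dots,m\}$. A twice continuously differentiable $h$ is $\mu$-strongly convex if $\mu I\preceq\nabla^2 h(x)$ for all $x$. Newton-type proximal gradient method: for $x\in\mathbb{R}^n$ let $d(x)=\arg\min_{d\in\mathbb{R}^n}\max_{i\in[m]}\{\langle\nabla f_i(x),d\rangle+g_i(x+d)-g_i(x)+\tfrac12\langle d,\nabla^2 f_i(x)d\rangle\}$ and let $\theta(x)$ be the optimal value. Given $x^0$ and $\sigma,\gamma\in(0,1)$, at iteration $k$ compute $d^k=d(x^k)$, $\theta^k=\theta(x^k)$, choose $t_k\in(0,1]$ as the largest element of $\{\gamma^j: j\in\mathbb{N},\ F_i(x^k+\gamma^j d^k)-F_i(x^k)\le \gamma^j\sigma\theta^k\ \forall i\in[m]\}$, and set $x^{k+1}=x^k+t_kd^k$. Standing assumption: the method generates an infinite sequence of points that are not Pareto critical ($d^k\ne0$ for all $k$); under the hypotheses this sequence converges to a Pareto solution $x^*$. *)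

(* Defs.v *)
From HB Require Import structures.
From mathcomp Require Import all_boot all_order all_algebra.
From mathcomp Require Import all_classical all_reals all_analysis.
Set Implicit Arguments. Unset Strict Implicit. Unset Printing Implicit Defensive.
Import Order.TTheory GRing.Theory Num.Theory.
Import numFieldNormedType.Exports.
Local Open Scope ring_scope.

Section Defs.
Variable R : realType.
Variable n : nat.
Notation V := 'rV[R]_n.

(* Euclidean inner product and norm on R^n (the library norm on 'rV is the sup norm) *)
Definition dotv (u v : V) : R := (u *m v^T) 0 0.
Definition enorm (u : V) : R := Num.sqrt (dotv u u).
Definition quadf (A : 'M[R]_n) (d : V) : R := (d *m A *m d^T) 0 0.

Definition C2_with (f : V -> R) (gf : V -> V) (hf : V -> 'M[R]_n) : Prop :=
  (forall x, differentiable f x) /\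
  (forall x v, 'd f x v = dotv (gf x) v) /\
  (forall x, differentiable gf x) /\
  (forall x v, 'd gf x v = v *m (hf x)^T) /\
  continuous hf.

Definition strongly_convex_hess (mu : R) (hf : V -> 'M[R]_n) : Prop :=
  forall x d, mu * dotv d d <= quadf (hf x) d.

(* Hessian is L2-Lipschitz w.r.t. the operator (spectral) norm induced by the
   Euclidean norm: ||(H x - H y) d|| <= L2 ||x - y|| ||d|| for all d. *)
Definition hess_lipschitz (L2 : R) (hf : V -> 'M[R]_n) : Prop :=
  forall x y d, enorm (d *m (hf x - hf y)^T) <= L2 * enorm (x - y) * enorm d.

Definition proper_fun (g : V -> \bar R) : Prop :=
  (forall x, g x != -oo%E) /\ (exists x, g x \is a fin_num).
Definition convex_efun (g : V -> \bar R) : Prop :=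
  forall (x y : V) (t : R), 0 <= t <= 1 ->
    (g (t *: x + (1 - t) *: y)%R <= t%:E * g x + (1 - t)%:E * g y)%E.

Definition sub_obj (m : nat) (gf : 'I_m -> V -> V) (hf : 'I_m -> V -> 'M[R]_n)
    (g : 'I_m -> V -> \bar R) (x d : V) : \bar R :=
  \big[maxe/-oo%E]_(i < m)
     ((dotv (gf i x) d)%:E + (g i (x + d)%R - g i x) + (quadf (hf i x) d / 2)%:E)%E.

Definition armijo (m : nat) (f : 'I_m -> V -> R) (g : 'I_m -> V -> \bar R)
    (sigma gamma : R) (x d : V) (theta : \bar R) (j : nat) : Prop :=
  forall i : 'I_m,
    ((f i (x + gamma ^+ j *: d)%R)%:E + g i (x + gamma ^+ j *: d)%R
      - ((f i x)%:E + g i x) <= (gamma ^+ j * sigma)%:E * theta)%E.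

Definition ntpg_sequence (m : nat) (f : 'I_m -> V -> R) (gf : 'I_m -> V -> V)
    (hf : 'I_m -> V -> 'M[R]_n) (g : 'I_m -> V -> \bar R)
    (sigma gamma : R) (x : nat -> V) : Prop :=
  forall k, exists (d : V) (j : nat),
    (forall d', (sub_obj gf hf g (x k) d <= sub_obj gf hf g (x k) d')%E) /\
    d != 0 /\
    armijo f g sigma gamma (x k) d (sub_obj gf hf g (x k) d) j /\
    (forall j', armijo f g sigma gamma (x k) d (sub_obj gf hf g (x k) d) j' ->
        gamma ^+ j' <= gamma ^+ j) /\
    x k.+1 = x k + gamma ^+ j *: d.

End Defs.

(* Main.v *)
(* No multipliers are needed. Write q_i for the quadratic model of f_i at x plus
   the increment of g_i, d for the Newton step, e = |x + d - xs|, a = |d|,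
   r = |x - xs|. Comparing d with d + s (y - d), y = xs - x, strong convexity
   yields for each s in (0, 1) an index i with
   q_i(d) + (1 - s) mu e^2 / 2 <= q_i(y). Since q_i agrees with the increment of
   F_i up to a Taylor remainder G_i with
   |G_i(y) - G_i(d)| <= L2 e (a^2 + a r + r^2) / 6, and F_i(xs) <= F_i(x + d)
   by lower semicontinuity and monotonicity, we get
   3 mu e <= L2 (a^2 + a r + r^2). The stated bound follows from a <= r + e, and
   e = O(r^2) forces tau = a / r -> 1. Unit steps are eventually accepted: a
   rejected one gives a lower bound on t^2 a <= t a = |x^{k+1} - x^k|, which
   tends to 0. *)
Require Import Defs.
From HB Require Import structures.
From mathcomp Require Import all_boot all_order all_algebra.
From mathcomp Require Import all_classical all_reals all_analysis.
From mathcomp Require Import ring lra.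
Set Implicit Arguments. Unset Strict Implicit. Unset Printing Implicit Defensive.
Import Order.TTheory GRing.Theory Num.Theory.
Import numFieldNormedType.Exports.
Local Open Scope classical_set_scope.
Local Open Scope ring_scope.

(** * Euclidean inner product, norm and quadratic forms *)

Section Euclid.
Context {R : realType} {n : nat}.
Implicit Types (u v w : 'rV[R]_n) (A B : 'M[R]_n) (a : R).

Lemma dotvE u v : dotv u v = \sum_j u 0 j * v 0 j.
Proof. by rewrite /dotv mxE; apply: eq_bigr => j _; rewrite mxE. Qed.

Lemma dotvC u v : dotv u v = dotv v u.
Proof. by rewrite !dotvE; apply: eq_bigr => j _; rewrite mulrC. Qed.

Lemma dotvDl u v w : dotv (u + v) w = dotv u w + dotv v w.
Proof. by rewrite /dotv mulmxDl mxE. Qed.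

Lemma dotvZl a u v : dotv (a *: u) v = a * dotv u v.
Proof. by rewrite /dotv -scalemxAl mxE. Qed.

Lemma dotvNl u v : dotv (- u) v = - dotv u v.
Proof. by rewrite -scaleN1r dotvZl mulN1r. Qed.

Lemma dotvBl u v w : dotv (u - v) w = dotv u w - dotv v w.
Proof. by rewrite dotvDl dotvNl. Qed.

Lemma dotvDr u v w : dotv w (u + v) = dotv w u + dotv w v.
Proof. by rewrite !(dotvC w) dotvDl. Qed.

Lemma dotvZr a u v : dotv u (a *: v) = a * dotv u v.
Proof. by rewrite !(dotvC u) dotvZl. Qed.

Lemma dotvNr u v : dotv u (- v) = - dotv u v.
Proof. by rewrite !(dotvC u) dotvNl. Qed.

Lemma dotvBr u v w : dotv w (u - v) = dotv w u - dotv w v.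
Proof. by rewrite dotvDr dotvNr. Qed.

Lemma dot0v u : dotv 0 u = 0.
Proof. by rewrite -(scale0r 0) dotvZl mul0r. Qed.

Lemma dotv0 u : dotv u 0 = 0.
Proof. by rewrite dotvC dot0v. Qed.

Lemma dotvv_ge0 u : 0 <= dotv u u.
Proof. by rewrite dotvE sumr_ge0 // => j _; rewrite -expr2 sqr_ge0. Qed.

Lemma enorm_ge0 u : 0 <= enorm u.
Proof. exact: sqrtr_ge0. Qed.

Lemma sqr_enorm u : enorm u ^+ 2 = dotv u u.
Proof. by rewrite sqr_sqrtr // dotvv_ge0. Qed.

Lemma enorm_eq0 u : (enorm u == 0) = (u == 0).
Proof.
apply/idP/eqP => [/eqP u0|->]; last by rewrite /enorm dot0v sqrtr0.
have : dotv u u == 0 by rewrite -sqr_enorm u0 expr0n.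
rewrite dotvE psumr_eq0 => [/allP u0'|j _]; last by rewrite -expr2 sqr_ge0.
apply/rowP => j; rewrite mxE; have := u0' j (mem_index_enum _).
by rewrite -expr2 sqrf_eq0 => /eqP.
Qed.

Lemma enorm_gt0 u : (0 < enorm u) = (u != 0).
Proof. by rewrite lt_neqAle enorm_ge0 andbT eq_sym enorm_eq0. Qed.

Lemma enormZ a u : enorm (a *: u) = `|a| * enorm u.
Proof.
rewrite /enorm dotvZl dotvZr mulrA -expr2 sqrtrM ?sqr_ge0 //.
by rewrite sqrtr_sqr.
Qed.

Lemma enormN u : enorm (- u) = enorm u.
Proof. by rewrite -scaleN1r enormZ normrN1 mul1r. Qed.

Lemma enormB u v : enorm (u - v) = enorm (v - u).
Proof. by rewrite -opprB enormN. Qed.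

(** Cauchy-Schwarz: expand the nonnegative square of [enorm v *: u - enorm u *: v]. *)
Lemma dotv_le u v : dotv u v <= enorm u * enorm v.
Proof.
have [->|u0] := eqVneq u 0; first by rewrite dot0v mulr_ge0 ?enorm_ge0.
have [->|v0] := eqVneq v 0; first by rewrite dotv0 mulr_ge0 ?enorm_ge0.
have nu : 0 < enorm u by rewrite enorm_gt0.
have nv : 0 < enorm v by rewrite enorm_gt0.
have := dotvv_ge0 (enorm v *: u - enorm u *: v).
rewrite !(dotvBl, dotvBr, dotvZl, dotvZr) (dotvC v u) -!sqr_enorm => h.
have {}h : 0 <= 2 * (enorm u * enorm v) * (enorm u * enorm v - dotv u v).
  by apply: le_trans h _; rewrite le_eqVlt; apply/orP; left; apply/eqP; ring.
by move: h; rewrite pmulr_rge0 ?subr_ge0 // !mulr_gt0.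
Qed.

Lemma ler_enormD u v : enorm (u + v) <= enorm u + enorm v.
Proof.
rewrite -(@ler_pXn2r _ 2) ?nnegrE ?addr_ge0 ?enorm_ge0 // sqrrD !sqr_enorm.
rewrite dotvDl !dotvDr (dotvC v u) -addrA [leRHS]addrAC.
by have := dotv_le u v; lra.
Qed.

Lemma enorm_convex u v a : 0 <= a <= 1 ->
  enorm (u + a *: (v - u)) <= (1 - a) * enorm u + a * enorm v.
Proof.
move=> /andP[a0 a1].
have -> : u + a *: (v - u) = (1 - a) *: u + a *: v.
  by rewrite scalerBr scalerBl scale1r addrCA addrC.
by apply: le_trans (ler_enormD _ _) _; rewrite !enormZ !ger0_norm // subr_ge0.
Qed.

Lemma mulmx_dotv_tr A u v : dotv (u *m A^T) v = dotv (v *m A) u.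
Proof.
transitivity ((u *m A^T *m v^T)^T 0 0); first by rewrite [RHS]mxE.
by rewrite !trmx_mul !trmxK mulmxA.
Qed.

Lemma quadfE A u : quadf A u = dotv (u *m A^T) u.
Proof. by rewrite mulmx_dotv_tr. Qed.

Lemma quadfZ A a u : quadf A (a *: u) = a ^+ 2 * quadf A u.
Proof. by rewrite !quadfE -scalemxAl dotvZl dotvZr mulrA. Qed.

Lemma quadf0 A : quadf A 0 = 0.
Proof. by rewrite quadfE dotv0. Qed.

(** Symmetry is assumed for one pair of vectors; [hess_sym] supplies it for Hessians. *)
Lemma quadfD A u v : dotv (v *m A^T) u = dotv (u *m A^T) v ->
  quadf A (u + v) = quadf A u + 2 * dotv (u *m A^T) v + quadf A v.
Proof.
by move=> sA; rewrite !quadfE mulmxDl dotvDl !dotvDr sA; ring.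
Qed.

(** Transfers convergence from the sup norm to the Euclidean norm. *)
Lemma enorm_le_norm u : enorm u <= Num.sqrt n%:R * `|u|.
Proof.
rewrite -{1}[`|u|]normr_id -sqrtr_sqr -sqrtrM ?ler0n // ler_wsqrtr // dotvE.
rewrite mulr_natl -[X in _ *+ X]card_ord -sumr_const.
apply: ler_sum => j _; rewrite -expr2 -real_normK ?num_real //.
rewrite lerXn2r ?nnegrE //.
by rewrite [leRHS]mx_normrE; apply: (le_bigmax _ (fun i => `|u i.1 i.2|) (0, j)).
Qed.

Lemma continuous_dotv v : continuous (fun u => dotv u v).
Proof.
move=> u; rewrite /continuous_at.
have -> : (fun w => dotv w v) = fun w : 'rV[R]_n => \sum_j w 0 j * v 0 j.
  by apply/funext => w; rewrite dotvE.
rewrite dotvE; apply: (@cvg_big _ _ _ _ _ _ _ (nbhs u)) => [|j _].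
  exact: add_continuous.
exact: (@cvgMl _ _ (nbhs u) _ _ _ _ (@coord_continuous _ _ _ 0 j u)).
Qed.

End Euclid.

(** * Mean value inequalities and derivatives along lines *)

Section MeanValue.
Context {R : realType}.
Implicit Types (phi psi : R -> R).

Lemma is_derive_cubic (a b c s : R) :
  is_derive s 1 (fun s => a * s + b * s ^+ 2 + c * s ^+ 3)
    (a + 2 * b * s + 3 * c * s ^+ 2).
Proof.
have d1 := is_derive_id s (1 : R).
have dX n := @is_deriveX _ _ id n s 1 1 d1.
have -> : (fun s => a * s + b * s ^+ 2 + c * s ^+ 3) =
    a \*: (id : R -> R) + b \*: (id : R -> R) ^+ 2 + c \*: (id : R -> R) ^+ 3.
  by apply/funext => t.
apply: (is_derive_eq (is_deriveD (is_deriveD (is_deriveZ a d1)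
  (is_deriveZ b (dX 2%N))) (is_deriveZ c (dX 3%N)))).
rewrite /GRing.scale /= !mulr1.
by ring.
Qed.

(** Mean value theorem for [psi - phi]. With a polynomial [psi] from [is_derive_cubic] it does the
    work of integrating a bound on [dphi]. *)
Lemma ler_derive_incr phi psi (dphi dpsi : R -> R) :
    (forall s : R, is_derive s 1 phi (dphi s)) ->
    (forall s : R, is_derive s 1 psi (dpsi s)) ->
    (forall s, 0 <= s <= 1 -> dphi s <= dpsi s) ->
  phi 1 - phi 0 <= psi 1 - psi 0.
Proof.
move=> dP dQ le_d.
have dB (s : R) : is_derive s 1 (psi - phi) (dpsi s - dphi s) by exact: is_deriveB.
have [|c] := MVT_segment ler01 (fun s _ => dB s).
  by apply: derivable_within_continuous => s _; have [] := dB s.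
rewrite in_itv /= => /le_d; rewrite subr0 mulr1 -subr_ge0 => c0 eqc.
rewrite -subr_ge0; apply: le_trans c0 _; rewrite -eqc le_eqVlt; apply/orP; left.
by apply/eqP; rewrite -![(psi - phi) _]/(psi _ - phi _); ring.
Qed.

Lemma mean_value_dist phi (dphi : R -> R) (c e : R) :
    (forall s : R, is_derive s 1 phi (dphi s)) ->
    (forall s, 0 <= s <= 1 -> `|dphi s - c| <= e) ->
  `|phi 1 - phi 0 - c| <= e.
Proof.
move=> dP bnd.
(* Affine comparison functions, used with the slopes [c - e] and [c + e]. *)
have line a (s : R) : is_derive s 1 (fun s => a * s + 0 * s ^+ 2 + 0 * s ^+ 3) a.
  by apply: (is_derive_eq (is_derive_cubic a 0 0 s)); ring.
rewrite ler_distl; apply/andP; split.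
- have := @ler_derive_incr _ _ (fun=> c - e) dphi (line (c - e)) dP.
  by rewrite expr1n expr0n /= => h; apply: le_trans (h _) => [|s /bnd];
     [lra|rewrite ler_distl => /andP[]].
- have := @ler_derive_incr _ _ dphi (fun=> c + e) dP (line (c + e)).
  by rewrite expr1n expr0n /= => h; apply: le_trans (h _) _ => [s /bnd|];
     [rewrite ler_distl => /andP[]|lra].
Qed.

Lemma is_derive_dotv n (F : R -> 'rV[R]_n) dF u (s : R) :
  is_derive s 1 F dF -> is_derive s 1 (fun s => dotv (F s) u) (dotv dF u).
Proof.
move=> [dF_ex dF_val].
have lim_dot : h^-1 *: (((fun s => dotv (F s) u) \o shift s) (h *: 1)
    - dotv (F s) u) @[h --> 0^'] --> dotv dF u.
  have -> : (fun h => h^-1 *: (((fun s => dotv (F s) u) \o shift s) (h *: 1)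
    - dotv (F s) u)) = (fun v => dotv v u) \o
      (fun h => h^-1 *: ((F \o shift s) (h *: 1) - F s)).
    by apply/funext => h /=; rewrite dotvZl dotvBl.
  apply: continuous_cvg; first exact: continuous_dotv.
  by rewrite -dF_val; exact: dF_ex.
by split; [apply/cvg_ex; exists (dotv dF u)|exact/cvg_lim].
Qed.

Lemma is_derive_line (V W : normedModType R) (f : V -> W) (x z : V) (s : R) :
  differentiable f (x + s *: z) ->
  is_derive s 1 (fun s => f (x + s *: z)) ('d f (x + s *: z) z).
Proof.
move=> df; have eq_quot :
    (fun h => h^-1 *: (((fun s => f (x + s *: z)) \o shift s) (h *: 1)
       - f (x + s *: z))) =
    (fun h => h^-1 *: ((f \o shift (x + s *: z)) (h *: z) - f (x + s *: z))).
  apply/funext => h /=; congr (_ *: (f _ - _)).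
  by rewrite [h *: 1]mulr1 scalerDl addrCA.
split; first by rewrite /derivable eq_quot; exact: diff_derivable.
by rewrite /derive eq_quot -deriveE.
Qed.

End MeanValue.

(** * Taylor estimates from the Lipschitz Hessian *)

Section Taylor.
Context {R : realType} {n : nat}.
Variables (f : 'rV[R]_n -> R) (gf : 'rV[R]_n -> 'rV[R]_n).
Variables (hf : 'rV[R]_n -> 'M[R]_n) (L : R).
Hypotheses (fC2 : C2_with f gf hf) (hfL : hess_lipschitz L hf) (L0 : 0 <= L).

Definition taylor2_rem x z :=
  f (x + z) - f x - dotv (gf x) z - quadf (hf x) z / 2.

Let is_derive_f_line x z (s : R) :
  is_derive s 1 (fun s => f (x + s *: z)) (dotv (gf (x + s *: z)) z).
Proof. by have [df [gfE _]] := fC2; rewrite -gfE; exact: is_derive_line. Qed.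

Let is_derive_gf_line x z u (s : R) :
  is_derive s 1 (fun s => dotv (gf (x + s *: z)) u)
    (dotv (z *m (hf (x + s *: z))^T) u).
Proof.
have [_ [_ [dgf [hfE _]]]] := fC2.
by rewrite -hfE; apply: is_derive_dotv; exact: is_derive_line.
Qed.

(** At parameter [s] of the segment the Hessian has moved by at most [L * s * enorm z]; integrating
    [s] brings the factor one half. *)
Lemma grad_remainder_le x z u :
  dotv (gf (x + z) - gf x - z *m (hf x)^T) u <= L / 2 * enorm z ^+ 2 * enorm u.
Proof.
pose b := L / 2 * enorm z ^+ 2 * enorm u.
have := @ler_derive_incr _ _ _ _ _ (is_derive_gf_line x z u)
  (is_derive_cubic (dotv (z *m (hf x)^T) u) b 0).
rewrite expr1n expr0n /= scale1r scale0r addr0 => h.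
rewrite !dotvBl lerBlDr -/b [leRHS]addrC; apply: le_trans (h _) _ => [s /andP[s0 s1]|].
  rewrite mulr0 mul0r addr0 -lerBlDl.
  rewrite (_ : _ - _ = dotv (z *m (hf (x + s *: z) - hf x)^T) u); last first.
    by rewrite linearB /= mulmxBr dotvBl; ring.
  apply: le_trans (dotv_le _ _) _.
  have := hfL (x + s *: z) x z; rewrite addrAC subrr add0r enormZ ger0_norm //.
  move=> /(ler_wpM2r (enorm_ge0 u)) hz; apply: le_trans hz _.
  by rewrite /b le_eqVlt; apply/orP; left; apply/eqP; field.
by lra.
Qed.

Lemma grad_remainder x z u :
  `|dotv (gf (x + z) - gf x - z *m (hf x)^T) u| <= L / 2 * enorm z ^+ 2 * enorm u.
Proof.
rewrite ler_norml grad_remainder_le andbT lerNl -dotvNr -(enormN u).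
exact: grad_remainder_le.
Qed.

(** The increment of [f] along [u] is followed in the direction [v]: its derivative is a difference
    of gradients, and two uses of [grad_remainder] cost [L / 2] each. *)
Lemma second_difference x u v :
  `|f (x + u + v) - f (x + v) - (f (x + u) - f x) - dotv (u *m (hf x)^T) v|
    <= L * (enorm u + enorm v) ^+ 3.
Proof.
pose phi (s : R) := f (x + u + s *: v) - f (x + s *: v).
have dphi (s : R) : is_derive s 1 phi
    (dotv (gf (x + u + s *: v)) v - dotv (gf (x + s *: v)) v).
  by apply: is_deriveB.
have := @mean_value_dist _ _ _ (dotv (u *m (hf x)^T) v)
  (L * (enorm u + enorm v) ^+ 3) dphi.
rewrite /phi scale1r scale0r !addr0; apply => s /andP[s0 s1].
have u0 := enorm_ge0 u; have v0 := enorm_ge0 v.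
have sv : enorm (s *: v) <= enorm u + enorm v.
  by rewrite enormZ ger0_norm //; nra.
have usv : enorm (u + s *: v) <= enorm u + enorm v.
  by apply: le_trans (ler_enormD _ _) _; rewrite enormZ ger0_norm //; nra.
have sq (w : 'rV[R]_n) : enorm w <= enorm u + enorm v ->
    L / 2 * enorm w ^+ 2 * enorm v <= L / 2 * (enorm u + enorm v) ^+ 3.
  move=> hw; rewrite -mulrA ler_wpM2l ?divr_ge0 // [leRHS]exprSr.
  apply: ler_pM; rewrite ?exprn_ge0 ?enorm_ge0 ?lerDr //.
  by rewrite lerXn2r ?nnegrE ?enorm_ge0 ?addr_ge0.
have := le_trans (grad_remainder x (u + s *: v) v) (sq _ usv).
have := le_trans (grad_remainder x (s *: v) v) (sq _ sv).
rewrite !ler_norml !mulmxDl !(dotvBl, dotvNl, dotvDl) (addrA x u).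
move=> /andP[h1 h2] /andP[h3 h4].
by apply/andP; split; lra.
Qed.

(* The second difference is symmetric in [u] and [v]: apply it to [t u], [t v] and let [t] tend to 0. *)
Lemma hess_sym x u v : dotv (u *m (hf x)^T) v = dotv (v *m (hf x)^T) u.
Proof.
pose M := L * (enorm u + enorm v) ^+ 3.
have M0 : 0 <= M by rewrite mulr_ge0 // exprn_ge0 // addr_ge0 // enorm_ge0.
have bnd (t : R) : 0 < t ->
    `|dotv (u *m (hf x)^T) v - dotv (v *m (hf x)^T) u| <= t * (2 * M).
  move=> t0; have := second_difference x (t *: u) (t *: v).
  have := second_difference x (t *: v) (t *: u).
  rewrite !enormZ !(ger0_norm (ltW t0)) -!mulrDr -!scalemxAl !(dotvZl, dotvZr).
  rewrite [x + _ + _]addrAC (addrC (enorm v)) exprMn.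
  rewrite !ler_norml => /andP[h1 h2] /andP[h3 h4].
  have t2 : 0 < t * t by rewrite mulr_gt0.
  by apply/andP; split; rewrite -subr_ge0 -(pmulr_rge0 _ t2) /M; lra.
apply/eqP; rewrite -subr_eq0 -normr_le0; apply/ler_addgt0Pl => e e0.
rewrite addr0; have M1 : 0 < 2 * M + 1 by lra.
apply: le_trans (bnd (e / (2 * M + 1)) (divr_gt0 e0 M1)) _.
by rewrite mulrAC ler_pdivrMr // ler_pM2l //; lra.
Qed.

(* Integrating [(1 - s) a + s b] squared over [0, 1] gives [(a^2 + ab + b^2) / 3]. *)
Lemma taylor2_rem_sub x y d :
  taylor2_rem x y - taylor2_rem x d <= L / 6 * enorm (y - d) *
    (enorm y ^+ 2 + enorm y * enorm d + enorm d ^+ 2).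
Proof.
pose w := y - d; have yE : y = d + w by rewrite /w addrC subrK.
pose c := L / 2 * enorm w; pose a := enorm d; pose b := enorm y.
(* The coefficients make the derivative the slope of the quadratic model plus
   [c * ((1 - s) * a + s * b) ^+ 2]. *)
have := @ler_derive_incr _ _ _ _ _ (is_derive_f_line (x + d) w)
  (is_derive_cubic (dotv (gf x) w + dotv (d *m (hf x)^T) w + c * a ^+ 2)
    (quadf (hf x) w / 2 + c * (a * b - a ^+ 2)) (c * (b - a) ^+ 2 / 3)).
rewrite scale1r scale0r !expr1n !expr0n /= addr0 -(addrA x d w) -yE => h.
have qy : quadf (hf x) y =
    quadf (hf x) d + 2 * dotv (d *m (hf x)^T) w + quadf (hf x) w.
  by rewrite [in LHS]yE quadfD // hess_sym.
have gy : dotv (gf x) y = dotv (gf x) d + dotv (gf x) w by rewrite -dotvDr -yE.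
rewrite -/w /taylor2_rem -/a -/b qy gy.
suff /h : forall s, 0 <= s <= 1 ->
  dotv (gf (x + d + s *: w)) w <=
    dotv (gf x) w + dotv (d *m (hf x)^T) w + c * a ^+ 2 +
    2 * (quadf (hf x) w / 2 + c * (a * b - a ^+ 2)) * s +
    3 * (c * (b - a) ^+ 2 / 3) * s ^+ 2.
  by rewrite /c; lra.
move=> s /andP[s0 s1].
have := grad_remainder_le x (d + s *: w) w.
rewrite !(dotvBl, mulmxDl, dotvNl, dotvDl) -scalemxAl dotvZl -quadfE addrA.
have : enorm (d + s *: w) <= (1 - s) * a + s * b by apply: enorm_convex; rewrite s0.
rewrite -(@ler_pXn2r _ 2) ?nnegrE ?addr_ge0 ?mulr_ge0 ?enorm_ge0 ?subr_ge0 //.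
have c0 : 0 <= c by rewrite mulr_ge0 ?divr_ge0 ?enorm_ge0.
move=> /(ler_wpM2l c0); rewrite /c; lra.
Qed.

Lemma taylor2_rem0 x : taylor2_rem x 0 = 0.
Proof. by rewrite /taylor2_rem addr0 subrr dotv0 quadf0 mul0r !subr0. Qed.

Lemma taylor2_rem_le x z : taylor2_rem x z <= L / 6 * enorm z ^+ 3.
Proof.
have := taylor2_rem_sub x z 0; rewrite taylor2_rem0 !subr0.
have -> : enorm (0 : 'rV[R]_n) = 0 by apply/eqP; rewrite enorm_eq0.
by rewrite mulr0 expr0n !addr0 -mulrA -exprS.
Qed.

End Taylor.

(** * Quadratic models of the composite objectives *)

Section NewtonStep.
Context {R : realType} {n m : nat}.
Variables (f : 'I_m -> 'rV[R]_n -> R) (gf : 'I_m -> 'rV[R]_n -> 'rV[R]_n).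
Variables (hf : 'I_m -> 'rV[R]_n -> 'M[R]_n) (g : 'I_m -> 'rV[R]_n -> \bar R).
Variables (mu L sigma gamma : R).

Definition in_dom z := forall i, g i z \is a fin_num.

(* Meaningful on the domain only: [fine] sends infinite values to 0. *)
Definition obj i z := f i z + fine (g i z).

(** Real form of the [i]-th term of [sub_obj], faithful when [g i] is finite at [x] and [x + d]. *)
Definition model x i d := dotv (gf i x) d + (fine (g i (x + d)) - fine (g i x))
  + quadf (hf i x) d / 2.

Hypotheses (m0 : (0 < m)%N) (gproper : forall i, proper_fun (g i)).
Hypothesis gconvex : forall i, convex_efun (g i).
Hypothesis fC2 : forall i, C2_with (f i) (gf i) (hf i).
Hypotheses (mu0 : 0 < mu) (fmu : forall i, strongly_convex_hess mu (hf i)).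
Hypotheses (hfL : forall i, hess_lipschitz L (hf i)) (L0 : 0 <= L).
Hypotheses (sigma01 : 0 < sigma < 1) (gamma01 : 0 < gamma < 1).

Lemma lty_dom i z : (g i z < +oo)%E -> g i z \is a fin_num.
Proof. by move=> gz; rewrite fin_real // ltNye (gproper i).1. Qed.

Lemma sub_termE x d i : g i x \is a fin_num -> g i (x + d) \is a fin_num ->
  ((dotv (gf i x) d)%:E + (g i (x + d)%R - g i x) + (quadf (hf i x) d / 2)%:E)%E
  = (model x i d)%:E.
Proof. by move=> gx gxd; rewrite -[g i x]fineK // -[g i (x + d)]fineK. Qed.

(** The increment of [g i] cancels, so the model error is that of the smooth part alone. *)
Lemma taylor2_remE x i z : taylor2_rem (f i) (gf i) (hf i) x z =
  obj i (x + z) - obj i x - model x i z.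
Proof. by rewrite /taylor2_rem /obj /model; ring. Qed.

Lemma model0 x i : model x i 0 = 0.
Proof. by rewrite /model addr0 dotv0 quadf0 subrr mul0r !addr0. Qed.

(** Convexity of [g i] plus the exact expansion of the quadratic part. Finiteness is included so
    that the intermediate point can compete in the subproblem. *)
Lemma model_strongly_convex (x d y : 'rV[R]_n) i (s : R) : 0 <= s <= 1 ->
    g i (x + d) \is a fin_num -> g i (x + y) \is a fin_num ->
  g i (x + (d + s *: (y - d))) \is a fin_num /\
  model x i (d + s *: (y - d)) <=
    (1 - s) * model x i d + s * model x i y
    - s * (1 - s) / 2 * mu * enorm (y - d) ^+ 2.
Proof.
move=> s01 gd gy; have /andP[s0 s1] := s01.
have := gconvex i (x + y) (x + d) s01.
rewrite (_ : s *: (x + y) + _ = x + (d + s *: (y - d))); last first.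
  by apply/rowP => j; rewrite !mxE; ring.
rewrite -[g i (x + y)]fineK // -[g i (x + d)]fineK // -!EFinM -EFinD => gs.
have gsfin : g i (x + (d + s *: (y - d))) \is a fin_num.
  by apply: lty_dom; apply: le_lt_trans gs _; rewrite ltry.
split=> //; move: gs; rewrite -[X in (X <= _)%E]fineK // lee_fin /model => gs.
pose w := y - d; have yE : y = d + w by rewrite /w addrC subrK.
have sym u v := hess_sym (fC2 i) (hfL i) L0 x u v.
have qy : quadf (hf i x) y =
    quadf (hf i x) d + 2 * dotv (d *m (hf i x)^T) w + quadf (hf i x) w.
  by rewrite [in LHS]yE (quadfD (sym w d)).
have qs : quadf (hf i x) (d + s *: w) = quadf (hf i x) d
    + s * (2 * dotv (d *m (hf i x)^T) w) + s ^+ 2 * quadf (hf i x) w.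
  by rewrite (quadfD (sym _ d)) dotvZr quadfZ; ring.
have gry : dotv (gf i x) y = dotv (gf i x) d + dotv (gf i x) w.
  by rewrite -dotvDr -yE.
rewrite -/w in gs *; rewrite qs dotvDr dotvZr qy gry.
have qw : mu * enorm w ^+ 2 <= quadf (hf i x) w by rewrite sqr_enorm fmu.
have s1s : 0 <= s * (1 - s) / 2 by rewrite !mulr_ge0 ?subr_ge0.
have := ler_wpM2l s1s qw; lra.
Qed.

(** * Optimality, line search and error of a single step *)

Section Minimizer.
Variables (x d : 'rV[R]_n).
Hypothesis xdom : in_dom x.
Hypothesis dmin : forall d',
  (sub_obj gf hf g x d <= sub_obj gf hf g x d')%E.

Let th := fine (sub_obj gf hf g x d).

(** The trial direction 0 has a finite value. *)
Lemma sub_obj_lty : (sub_obj gf hf g x d < +oo)%E.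
Proof.
apply: le_lt_trans (dmin 0) _; apply: bigmax_lt => // i _.
by rewrite sub_termE ?addr0 ?ltry.
Qed.

Lemma minimizer_dom : in_dom (x + d).
Proof.
move=> i; apply: lty_dom; rewrite ltey; apply/eqP => gy.
have := sub_obj_lty; rewrite ltNge => /negP; apply.
by apply: le_trans (le_bigmax _ _ i); rewrite gy -[g i x]fineK.
Qed.

Lemma sub_obj_fin : sub_obj gf hf g x d \is a fin_num.
Proof.
rewrite fin_real // sub_obj_lty andbT.
apply: lt_le_trans (le_bigmax _ _ (Ordinal m0)).
by rewrite sub_termE ?ltNyr //; exact: minimizer_dom.
Qed.

Lemma model_le_theta i : model x i d <= th.
Proof.
rewrite -lee_fin /th fineK ?sub_obj_fin //.
by rewrite -sub_termE //; [exact: (le_bigmax _ _ i)|exact: minimizer_dom].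
Qed.

Lemma theta_le_model d' : in_dom (x + d') -> exists i, th <= model x i d'.
Proof.
move=> d'dom; apply: contrapT => nex.
have : (sub_obj gf hf g x d' < th%:E)%E.
  apply: bigmax_lt => [|i _]; first exact: ltNyr.
  by rewrite sub_termE // lte_fin ltNge; apply/negP => h; apply: nex; exists i.
by rewrite /th fineK ?sub_obj_fin // ltNge dmin.
Qed.

(** Test optimality against [d + s *: (y - d)]: some index has model value at least [th] there,
    while its value at [d] is at most [th]. Strong convexity and division by [s] conclude; the index
    may depend on [s]. *)
Lemma model_growth y (s : R) : 0 < s < 1 -> in_dom (x + y) ->
  exists2 i, th + (1 - s) / 2 * mu * enorm (y - d) ^+ 2 <= model x i y
    & model x i d + (1 - s) / 2 * mu * enorm (y - d) ^+ 2 <= model x i y.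
Proof.
move=> /andP[s0 s1] ydom; have s01 : 0 <= s <= 1 by rewrite !ltW.
have ms i := model_strongly_convex s01 (minimizer_dom i) (ydom i).
have [i thi] := theta_le_model (fun i => (ms i).1).
have := ms i => -[_ msi]; have mi := model_le_theta i.
have e0 : 0 <= mu * enorm (y - d) ^+ 2.
  by rewrite mulr_ge0 ?exprn_ge0 ?enorm_ge0 ?ltW.
have key : s * (model x i d + (1 - s) / 2 * mu * enorm (y - d) ^+ 2) <=
  s * model x i y by lra.
have key' : s * (th + (1 - s) / 2 * mu * enorm (y - d) ^+ 2) <= s * model x i y.
  have : (1 - s) * model x i d <= (1 - s) * th by rewrite ler_wpM2l // subr_ge0 ltW.
  lra.
by exists i; rewrite -(ler_pM2l s0).
Qed.

(** Growth at [y = 0] with [s = 1 / 2]. *)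
Lemma theta_le : th <= - (mu / 4) * enorm d ^+ 2.
Proof.
have [||i h _] := @model_growth 0 (1 / 2); first by lra.
  by rewrite addr0.
by move: h; rewrite model0 sub0r enormN; lra.
Qed.

Lemma theta_lt0 : d != 0 -> th < 0.
Proof.
move=> d0; apply: le_lt_trans theta_le _; rewrite mulNr oppr_lt0.
by rewrite mulr_gt0 ?divr_gt0 // exprn_gt0 // enorm_gt0.
Qed.

(** The right side of the Armijo test is finite, which keeps the new point in the domain, and
    negative, which forces strict decrease. *)
Lemma armijo_descent j : d != 0 ->
    armijo f g sigma gamma x d (sub_obj gf hf g x d) j ->
  in_dom (x + gamma ^+ j *: d) /\
  forall i, obj i (x + gamma ^+ j *: d) < obj i x.
Proof.
move=> d0 arm; have /andP[sg0 _] := sigma01; have /andP[ga0 _] := gamma01.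
have c0 : gamma ^+ j * sigma * th < 0.
  by rewrite pmulr_rlt0 ?theta_lt0 // mulr_gt0 ?exprn_gt0.
have tdom : in_dom (x + gamma ^+ j *: d).
  move=> i; apply: lty_dom; rewrite ltey; apply/eqP => gy.
  have := arm i; rewrite gy -[g i x]fineK //.
  by rewrite -[sub_obj _ _ _ _ _]fineK // sub_obj_fin.
split=> // i; have := arm i.
rewrite -[sub_obj _ _ _ _ _]fineK ?sub_obj_fin // -/th.
rewrite -[g i x]fineK // -[g i (x + _)]fineK // -!EFinD -EFinM lee_fin.
by rewrite -/(obj i x) -/(obj i _) -subr_lt0 => h; apply: le_lt_trans c0.
Qed.

(** With [t = gamma ^+ j], the Taylor error [L / 6 * (t * enorm d) ^+ 3] must fit into the slack
    [- t * (1 - sigma) * th], which [theta_le] bounds below; the condition is this comparison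
    divided by [t * enorm d ^+ 2 / 12]. *)
Lemma armijo_small_step j :
    2 * L * (gamma ^+ j) ^+ 2 * enorm d <= 3 * (1 - sigma) * mu ->
  armijo f g sigma gamma x d (sub_obj gf hf g x d) j.
Proof.
have /andP[ga0 ga1] := gamma01; have /andP[sg0 sg1] := sigma01.
set t := gamma ^+ j => small i.
have t0 : 0 < t by rewrite exprn_gt0.
have t1 : t <= 1 by rewrite exprn_ile1 // ltW.
have [||tfin] := @model_strongly_convex x 0 d i t _ _ (minimizer_dom i).
- by rewrite ltW.
- by rewrite addr0.
rewrite model0 mulr0 subr0 !add0r in tfin * => mt.
have := taylor2_rem_le (fC2 i) (hfL i) L0 x (t *: d).
rewrite taylor2_remE enormZ (ger0_norm (ltW t0)) exprMn => rem.
rewrite -[sub_obj _ _ _ _ _]fineK ?sub_obj_fin // -/th.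
rewrite -[g i x]fineK // -[g i (x + _)]fineK // -!EFinD -EFinM lee_fin.
rewrite -/(obj i x) -/(obj i _).
have D0 := enorm_ge0 d; set D := enorm d in D0 small rem mt *.
have mth : t * model x i d <= t * th by rewrite ler_pM2l // model_le_theta.
have q0 : 0 <= t * (1 - t) / 2 * mu * D ^+ 2.
  by rewrite !mulr_ge0 ?subr_ge0 ?exprn_ge0 ?invr_ge0 // ltW.
have thD : t * (1 - sigma) * th <= t * (1 - sigma) * (- (mu / 4) * D ^+ 2).
  by rewrite ler_wpM2l ?theta_le // mulr_ge0 ?subr_ge0 ?ltW.
have c0 : 0 <= t * D ^+ 2 / 12.
  by rewrite !mulr_ge0 ?exprn_ge0 ?invr_ge0 // ltW.
have := ler_wpM2l c0 small; rewrite -/t; lra.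
Qed.

(** Otherwise the previous, longer trial step would pass [armijo_small_step], against maximality;
    passing back one trial costs [gamma ^+ 2]. The bound is on the actual displacement, which
    vanishes along a convergent sequence. *)
Lemma unit_step j :
    (forall j', armijo f g sigma gamma x d (sub_obj gf hf g x d) j' ->
      gamma ^+ j' <= gamma ^+ j) ->
    2 * L * enorm (gamma ^+ j *: d) < 3 * (1 - sigma) * mu * gamma ^+ 2 ->
  j = 0%N.
Proof.
case: j => // j jmax small; have /andP[ga0 ga1] := gamma01.
have t0 : 0 < gamma ^+ j by rewrite exprn_gt0.
have t1 : gamma ^+ j <= 1 by rewrite exprn_ile1 // ltW.
have : gamma ^+ j <= gamma ^+ j.+1.
  apply: jmax; apply: armijo_small_step => //.
  rewrite -(ler_pM2r (exprn_gt0 2 ga0)); apply: le_trans (ltW small).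
  rewrite enormZ (ger0_norm (ltW (exprn_gt0 _ ga0))) [gamma ^+ j.+1]exprS.
  have := enorm_ge0 d; set D := enorm d; set t := gamma ^+ j in t0 t1 * => D0.
  have : 0 <= 2 * L * D * gamma * t * (1 - gamma * t).
    by rewrite !mulr_ge0 ?subr_ge0 ?mulr_ile1 // ltW.
  by lra.
by rewrite exprS ler_pMl // leNgt ga1.
Qed.

(** Growth at [y = z - x] bounds the squared error by a difference of models, hence by a difference
    of Taylor remainders since [z] is no worse than [x + d]. All indices are compared because growth
    does not say which one it selects. *)
Lemma newton_step_error z : in_dom z -> (forall i, obj i z <= obj i (x + d)) ->
  3 * mu * enorm (x + d - z) <=
    L * (enorm d ^+ 2 + enorm d * enorm (x - z) + enorm (x - z) ^+ 2).
Proof.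
move=> zdom zle; pose y := z - x; have zE : x + y = z by rewrite /y addrC subrK.
have -> : enorm (x + d - z) = enorm (y - d).
  by rewrite enormB /y opprD addrA.
have -> : enorm (x - z) = enorm y by rewrite enormB.
set B := enorm d ^+ 2 + _ + _.
have [a0 b0] := (enorm_ge0 d, enorm_ge0 y).
have B0 : 0 <= B by rewrite !addr_ge0 ?mulr_ge0 ?exprn_ge0.
have growth (s : R) : 0 < s < 1 ->
    (1 - s) / 2 * mu * enorm (y - d) ^+ 2 <= L / 6 * enorm (y - d) * B.
  move=> s01; have [|i _] := @model_growth y s s01; first by rewrite zE.
  have := taylor2_rem_sub (fC2 i) (hfL i) L0 x d y.
  rewrite !taylor2_remE zE (enormB d) -/B => h1 h2; have := zle i; lra.
have [->|e0] := eqVneq (enorm (y - d)) 0; first by rewrite mulr0 mulr_ge0.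
have {}e0 : 0 < enorm (y - d) by rewrite lt_neqAle eq_sym e0 enorm_ge0.
set X := 3 * mu * _; set Y := L * B.
have Y0 : 0 <= Y by rewrite mulr_ge0.
have X0 : 0 < X by rewrite !mulr_gt0.
have {}growth (s : R) : 0 < s < 1 -> (1 - s) * X <= Y.
  by move=> /growth h; rewrite -(ler_pM2l e0) /X /Y; lra.
rewrite leNgt; apply/negP => YX.
(* Replaces the limit [s] to 0: this [s] gives [(1 - s) * X = (X + Y) / 2], which exceeds [Y]. *)
have s01 : 0 < (X - Y) / (2 * X) < 1.
  by rewrite divr_gt0 ?ltr_pdivrMr; lra.
have e : (X - Y) / (2 * X) * X = (X - Y) / 2 by field; rewrite gt_eqF.
by have := growth _ s01; rewrite mulrBl mul1r e; lra.
Qed.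

End Minimizer.

Lemma ntpg_descent x : in_dom (x 0%N) -> ntpg_sequence f gf hf g sigma gamma x ->
  forall k, in_dom (x k) /\ forall i, obj i (x k.+1) < obj i (x k).
Proof.
move=> x0dom xseq.
have step k : in_dom (x k) ->
    in_dom (x k.+1) /\ forall i, obj i (x k.+1) < obj i (x k).
  move=> xdom; have [d [j [dmin [d0 [arm [_ ->]]]]]] := xseq k.
  exact: armijo_descent arm.
have dom k : in_dom (x k) by elim: k => // k /step[].
by move=> k; split=> //; have [] := step k (dom k).
Qed.

End NewtonStep.

(** * Passing to the limit point *)

Lemma cvg_enorm_lt (R : realType) n (x : nat -> 'rV[R]_n) (xs : 'rV[R]_n) (e : R) : 0 < e ->
  x @ \oo --> xs -> \forall k \near \oo, enorm (x k - xs) < e.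
Proof.
(* Adding 1 keeps the divisor positive when [n = 0]. *)
move=> e0 xxs; have M0 : 0 < Num.sqrt n%:R + 1 :> R by rewrite ltr_wpDl ?sqrtr_ge0.
have e1 : 0 < e / (Num.sqrt n%:R + 1) by rewrite divr_gt0.
move/cvgrPdist_lt : xxs => /(_ _ e1); apply: filterS => k.
rewrite ltr_pdivlMr // enormB => h; apply: le_lt_trans (enorm_le_norm _) _.
by apply: le_lt_trans h; rewrite mulrC ler_wpM2l // lerDl.
Qed.

(** With [f] moved to the right side, [g xs] may a priori be infinite, and its finiteness can be
    deduced from the bound. *)
Lemma lower_semicontinuous_cvg_le (R : realType) (V : normedModType R)
    (f : V -> R) (g : V -> \bar R) (x : nat -> V) (xs : V) (c : R) :
    {for xs, continuous f} -> lower_semicontinuous g -> x @ \oo --> xs ->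
    (\forall k \near \oo, (g (x k) <= (c - f (x k))%:E)%E) ->
  (g xs <= (c - f xs)%:E)%E.
Proof.
move=> fc glsc xxs le_c; rewrite leNgt; apply/negP => gt_c.
have [a ca ag] : exists2 a : R, c - f xs < a & (a%:E < g xs)%E.
  move: gt_c; case: (g xs) => [r| |//].
  - by rewrite lte_fin => /midf_lt[? ?]; exists ((c - f xs + r) / 2); rewrite ?lte_fin.
  - by move=> _; exists (c - f xs + 1); rewrite ?ltry // ltrDl.
have [U Uxs Ua] := glsc xs a ag.
have fx : f (x k) @[k --> \oo] --> f xs by exact: continuous_cvg.
have gap : 0 < a - (c - f xs) by rewrite subr_gt0.
move/cvgrPdist_lt : fx => /(_ _ gap) fx.
have xU : \forall k \near \oo, U (x k) by exact: xxs.
have [k [[/Ua ak ck] fk]] := filter_ex (filterI (filterI xU le_c) fx).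
have := lt_le_trans ak ck; rewrite lte_fin ltNge => /negP; apply.
by move: fk; rewrite ltr_norml => /andP[_ fk]; clear -fk; lra.
Qed.

(** * Scalar inequalities for the rate and the ratio interval *)

Section Quadratic.
Context {R : realType}.
Implicit Types (mu L a e r : R).

(** Inserting [a <= r + e] gives [L * (3 * r ^+ 2 + e * (3 * r + e))]; smallness absorbs the second
    part into [mu * e]. *)
Lemma quadratic_of_step mu L a e r : 0 < mu -> 0 <= L -> 0 <= a -> 0 <= e -> 0 < r ->
    a <= r + e -> L * (3 * r + e) <= mu ->
    3 * mu * e <= L * (a ^+ 2 + a * r + r ^+ 2) ->
  2 * mu * e <= 3 * L * r ^+ 2.
Proof.
move=> mu0 L0 a0 e0 r0 are small h.
have h1 : L * (a ^+ 2 + a * r + r ^+ 2) <=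
    L * ((r + e) ^+ 2 + (r + e) * r + r ^+ 2).
  rewrite ler_wpM2l // lerD2r lerD ?ler_wpM2r ?(ltW r0) //.
  by rewrite lerXn2r ?nnegrE // addr_ge0 // ltW.
have h2 := ler_wpM2l e0 small; lra.
Qed.

(** Only one factor of [a ^+ 2] is replaced by [r + e], so that [L * a * e] moves to the left and
    forms the denominator; smallness makes it positive. *)
Lemma step_bound mu L a e r : 0 < mu -> 0 <= L -> 0 <= a -> 0 <= e -> 0 < r ->
    a <= r + e -> L * (3 * r + e) <= mu ->
    3 * mu * e <= L * (a ^+ 2 + a * r + r ^+ 2) ->
  e <= (2 * (a / r) + 1) * L / (3 * mu - a / r * L * r) * r ^+ 2.
Proof.
move=> mu0 L0 a0 e0 r0 are small h.
have den : 0 < 3 * mu - L * a.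
  have : L * a <= L * (r + e) by rewrite ler_wpM2l.
  have : 0 <= L * r by rewrite mulr_ge0 // ltW.
  lra.
have -> : a / r * L * r = L * a by field; rewrite gt_eqF.
rewrite mulrAC ler_pdivlMr //.
have -> : (2 * (a / r) + 1) * L * r ^+ 2 = L * (2 * a * r + r ^+ 2).
  by field; rewrite gt_eqF.
have : L * a * a <= L * a * (r + e) by rewrite ler_wpM2l // mulr_ge0.
lra.
Qed.

(** Since 1 is interior, any ratio tending to 1 ends up in the interval. The square root exceeds
    [eps] because [eps < mu]. *)
Lemma tau_interval_1 mu eps : 0 < eps < mu ->
  (mu - Num.sqrt (2 * mu * eps - eps ^+ 2)) / (mu - eps) < 1 <
  (mu + Num.sqrt (2 * mu * eps - eps ^+ 2)) / (mu - eps).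
Proof.
move=> /andP[e0 emu]; have den : 0 < mu - eps by rewrite subr_gt0.
have S : eps < Num.sqrt (2 * mu * eps - eps ^+ 2).
  rewrite -[ltLHS]ger0_norm ?(ltW e0) // -sqrtr_sqr ltr_sqrt; first by nra.
  by nra.
by rewrite ltr_pdivrMr // ltr_pdivlMr // !mul1r; apply/andP; split; lra.
Qed.

End Quadratic.

(** Test the Lipschitz bound at [d] and 0; the first search direction will serve as [d]. *)
Lemma hess_lipschitz_ge0 (R : realType) n (L : R) (hf : 'rV[R]_n -> 'M[R]_n)
    (d : 'rV[R]_n) :
  hess_lipschitz L hf -> d != 0 -> 0 <= L.
Proof.
move=> hfL d0; have := le_trans (enorm_ge0 _) (hfL d 0 d).
by rewrite subr0 !pmulr_lge0 ?enorm_gt0.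
Qed.

(** * Rate and ratio along the whole sequence *)

Theorem theorem5 (R : realType) (n m : nat)
    (f : 'I_m -> 'rV[R]_n -> R) (gf : 'I_m -> 'rV[R]_n -> 'rV[R]_n)
    (hf : 'I_m -> 'rV[R]_n -> 'M[R]_n) (g : 'I_m -> 'rV[R]_n -> \bar R)
    (mu L2 sigma gamma : R) (x : nat -> 'rV[R]_n) (xstar : 'rV[R]_n) :
  (0 < m)%N ->
  (forall i, proper_fun (g i) /\ convex_efun (g i) /\ lower_semicontinuous (g i)) ->
  (forall i, C2_with (f i) (gf i) (hf i)) ->
  0 < mu ->
  (forall i, strongly_convex_hess mu (hf i)) ->
  (forall i, hess_lipschitz L2 (hf i)) ->
  0 < sigma < 1 -> 0 < gamma < 1 ->
  (forall i, g i (x 0%N) \is a fin_num) ->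
  ntpg_sequence f gf hf g sigma gamma x ->
  x @ \oo --> xstar ->
  (forall eps, 0 < eps <= (1 - sigma) * mu ->
    exists K : nat, (0 < K)%N /\ forall k : nat, (K <= k)%N ->
      let tau := enorm (x k.+1 - x k) / enorm (x k - xstar) in
      enorm (x k.+1 - xstar) <=
        (2 * tau + 1) * L2 / (3 * mu - tau * L2 * enorm (x k - xstar))
          * enorm (x k - xstar) ^+ 2
      /\ (mu - Num.sqrt (2 * mu * eps - eps ^+ 2)) / (mu - eps) <= tau
      /\ tau <= (mu + Num.sqrt (2 * mu * eps - eps ^+ 2)) / (mu - eps))
  /\
  (exists C : R, 0 < C /\ exists K : nat, forall k : nat, (K <= k)%N ->
      enorm (x k.+1 - xstar) <= C * enorm (x k - xstar) ^+ 2).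

Proof.
move=> m0 gP fC2 mu0 fmu hfL sg01 ga01 x0dom xseq xcv.
have gproper i := (gP i).1; have gconvex i := (gP i).2.1.
have glsc i := (gP i).2.2; pose i0 := Ordinal m0.
have L0 : 0 <= L2.
  by have [d [_ [_ [d0 _]]]] := xseq 0%N; exact: hess_lipschitz_ge0 (hfL i0) d0.
(* Divisor for the smallness thresholds: 4 collects the weights of two successive errors, and adding
   1 covers [L2 = 0]. *)
have L1 : 0 < 4 * (L2 + 1) by rewrite mulr_gt0 // ltr_wpDl.
have desc := ntpg_descent m0 gproper gconvex fC2 mu0 fmu hfL L0 sg01 ga01 x0dom xseq.
have xdom k := (desc k).1.
have mono i k l : (k <= l)%N -> obj f g i (x l) <= obj f g i (x k).
  move=> /subnK <-; elim: (l - k)%N => // p; apply: le_trans.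
  by rewrite addSn ltW ?(desc _).2.
(* Fix [k]: later objective values stay below the one at [k], and lower semicontinuity passes this
   to the limit. *)
have star_le i k : (g i xstar <= (obj f g i (x k) - f i xstar)%:E)%E.
  apply: (@lower_semicontinuous_cvg_le _ _ (f i) _ x) => //.
    by apply: differentiable_continuous; have [] := fC2 i.
  exists k => // l /= kl; rewrite -[g i (x l)]fineK ?xdom // lee_fin.
  by rewrite lerBrDl mono.
have stardom : in_dom g xstar.
  by move=> i; apply: lty_dom => //; apply: le_lt_trans (star_le i 0%N) (ltry _).
have star_obj i k : obj f g i xstar <= obj f g i (x k).
  by rewrite -lerBrDl -lee_fin fineK.
pose r k := enorm (x k - xstar); pose a k := enorm (x k.+1 - x k).
have r0 k : 0 <= r k by exact: enorm_ge0.
have a0 k : 0 <= a k by exact: enorm_ge0.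
(* An iterate equal to [xstar] would be followed by a strictly better point, although [xstar] is no
   worse than any iterate. *)
have rgt0 k : 0 < r k.
  rewrite enorm_gt0 subr_eq0; apply/eqP => xk.
  by have := (desc k).2 i0; rewrite ltNge xk star_obj.
have are k : a k <= r k + r k.+1.
  rewrite /a -(subrKA xstar) addrC (le_trans (ler_enormD _ _)) //.
  by rewrite [enorm (xstar - _)]enormB.
have ran k : r k <= a k + r k.+1.
  rewrite /r -(subrKA (x k.+1)); apply: le_trans (ler_enormD _ _) _.
  by rewrite [enorm (x k - _)]enormB.
have r_small e : 0 < e -> exists K, forall k, (K <= k)%N -> r k < e.
  by move=> e0; have [K _ h] := cvg_enorm_lt e0 xcv; exists K => k /h.
(* Displacements tend to 0, so [unit_step] eventually makes [x k.+1] the full Newton point. *)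
have [K1 step_err] : exists K, forall k, (K <= k)%N ->
    3 * mu * r k.+1 <= L2 * (a k ^+ 2 + a k * r k + r k ^+ 2).
  have /andP[ga0 _] := ga01; have /andP[_ sg1] := sg01.
  pose b := 3 * (1 - sigma) * mu * gamma ^+ 2.
  have b0 : 0 < b by rewrite !mulr_gt0 ?subr_gt0 ?exprn_gt0.
  have [K hK] := r_small (b / (4 * (L2 + 1))) (divr_gt0 b0 L1).
  exists K => k Kk; have [d [j [dmin [d0 [_ [jmax xk1]]]]]] := xseq k.
  have ak : a k = enorm (gamma ^+ j *: d) by rewrite /a xk1 addrAC subrr add0r.
  have j0 : j = 0%N.
    apply: (unit_step m0 gproper gconvex fC2 mu0 fmu hfL L0 sg01 ga01 (xdom k) dmin jmax).
    rewrite -ak -/b; have La := ler_wpM2l L0 (are k).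
    have := hK k Kk; have := hK k.+1 (leqW Kk); rewrite !ltr_pdivlMr // => h1 h2.
    by have rk := r0 k; have rk1 := r0 k.+1; lra.
  have xkd : x k.+1 = x k + d by rewrite xk1 j0 scale1r.
  rewrite /r /a xkd [x k + d - x k]addrAC subrr add0r.
  apply: (newton_step_error m0 gproper gconvex fC2 mu0 fmu hfL L0 (xdom k) dmin) => // i.
  by rewrite -xkd.
have [K2 small] : exists K, forall k, (K <= k)%N -> L2 * (3 * r k + r k.+1) <= mu.
  have [K hK] := r_small (mu / (4 * (L2 + 1))) (divr_gt0 mu0 L1).
  exists K => k Kk; have := hK k Kk; have := hK k.+1 (leqW Kk).
  rewrite !ltr_pdivlMr // => h1 h2.
  by have rk := r0 k; have rk1 := r0 k.+1; lra.
(* The quotient comes from [quadratic_of_step]; adding 1 makes [C] positive when [L2 = 0]. *)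
pose C := 3 * L2 / (2 * mu) + 1.
have mu2 : 0 < 2 * mu by rewrite mulr_gt0.
have C0 : 0 < C by rewrite ltr_wpDl // divr_ge0 ?mulr_ge0 // ltW.
have quad k : (maxn K1 K2 <= k)%N -> r k.+1 <= C * r k ^+ 2.
  rewrite geq_max => /andP[k1 k2].
  have q := quadratic_of_step mu0 L0 (a0 k) (r0 k.+1) (rgt0 k) (are k) (small k k2)
    (step_err k k1).
  rewrite -(ler_pM2l mu2).
  have -> : 2 * mu * (C * r k ^+ 2) = 3 * L2 * r k ^+ 2 + 2 * mu * r k ^+ 2.
    by rewrite /C; field; rewrite gt_eqF.
  have : 0 <= 2 * mu * r k ^+ 2 by rewrite mulr_ge0 ?exprn_ge0 ?ltW.
  by lra.
split; last by exists C; split=> //; exists (maxn K1 K2).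
move=> eps /andP[eps0 eps1].
have epsmu : 0 < eps < mu.
  by rewrite eps0 (le_lt_trans eps1) // gtr_pMl // ltrBlDr ltrDl; case/andP: sg01.
have := tau_interval_1 epsmu.
set lo := (_ / _); set hi := (_ / _) => /andP[lo1 hi1].
(* The triangle inequality puts [tau] within [r k.+1 / r k <= C * r k] of 1. *)
have del0 : 0 < Num.min (1 - lo) (hi - 1) / C.
  by rewrite divr_gt0 // lt_min !subr_gt0 lo1.
have [K3 hK3] := r_small _ del0.
exists (maxn K1 K2 + K3).+1; split=> // k Kk tau.
have k12 : (maxn K1 K2 <= k)%N by apply: leq_trans (ltnW Kk); rewrite leq_addr.
have k3 : (K3 <= k)%N by apply: leq_trans (ltnW Kk); rewrite leq_addl.
have := k12; rewrite geq_max => /andP[k1 k2].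
split.
  exact: step_bound mu0 L0 (a0 k) (r0 k.+1) (rgt0 k) (are k) (small k k2)
    (step_err k k1).
have := hK3 k k3; rewrite ltr_pdivlMr // lt_min => /andP[rlo rhi].
have q := quad k k12.
rewrite /tau -/(a k) -/(r k) ler_pdivlMr // ler_pdivrMr //.
have ra := are k; have rn := ran k.
have := ler_wpM2r (r0 k) (ltW rlo); have := ler_wpM2r (r0 k) (ltW rhi).
by split; lra.
Qed.
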